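(* Fix $a<0<b$ and $0<q<1$. Consider pairs $(\mu_q,\tau_q)$, where $\mu_q\in\mathcal{M}[a,b]$ is a probability measure on $[a,b]$ and $\tau_q$ is the Rayleigh measure of some continual diagram in $\mathcal{D}[a,b]$, satisfying $$\int_a^b\frac{\mu_q(ds)}{1-q^{x-s}}=\exp\Big[\int_a^b\ln\Big(\frac{1}{1-q^{x-s}}\Big)\tau_q(ds)\Big]$$ for all real $x$ outside $[a,b]$. Then $\mu_q$ and $\tau_q$ determine each other uniquely: if $(\mu_q,\tau_q)$ and $(\mu'_q,\tau'_q)$ are two such pairs, then $\mu_q=\mu'_q$ if and only if $\tau_q=\tau'_q$.
   Context: A continual diagram is a function $w:\mathbb{R}\to\mathbb{R}$ with $|w(s_1)-w(s_2)|\leq|s_1-s_2|$ for all $s_1,s_2$ such that there is $s_0\in\mathbb{R}$ with $w(s)=|s-s_0|$ for $|s|$ large. For fixed $a<0<b$, $\mathcal{D}[a,b]$ is the set of continual diagrams with $w(s)=|s-s_0|$ for all $s\notin[a,b]$, and $\mathcal{M}[a,b]$ is the set of probability measures on $[a,b]$. The Rayleigh measure of $w\in\mathcal{D}[a,b]$ is the signed measure $\tau$ whose distribution function is $F(s)=\frac12(1+w'(s))$; it is supported on $[a,b]$. *)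

(* Defs.v *)
From HB Require Import structures.
From mathcomp Require Import all_boot all_order all_algebra.
From mathcomp Require Import all_classical all_reals all_analysis.
From mathcomp Require Import complex.

Set Implicit Arguments.
Unset Strict Implicit.
Unset Printing Implicit Defensive.

Import Order.TTheory GRing.Theory Num.Theory.
Import numFieldNormedType.Exports.

Local Open Scope classical_set_scope.
Local Open Scope ring_scope.
Local Open Scope complex_scope.

Definition continual_diagram (R : realType) (w : R -> R) : Prop :=
  (forall s1 s2 : R, `|w s1 - w s2| <= `|s1 - s2|) /\
  (exists s0 M : R, forall s : R, M < `|s| -> w s = `|s - s0|).

Definition diagram_on (R : realType) (a b : R) (w : R -> R) : Prop :=
  continual_diagram w /\
  (exists s0 : R, forall s : R, s \notin `[a, b] -> w s = `|s - s0|).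

Definition probability_on (R : realType) (a b : R)
    (mu : probability (measurableTypeR R) R) : Prop :=
  mu `[a, b]%classic = 1%E.

(* w is Lipschitz, so w' exists almost everywhere; since w is then a primitive
   of w', prescribing the (right-continuous) distribution function of tau at
   all points of differentiability of w is the same as prescribing it almost
   everywhere, and determines tau. *)
Definition rayleigh_measure_of (R : realType) (w : R -> R)
    (tau : {charge set (measurableTypeR R) -> \bar R}) : Prop :=
  forall s : R, derivable w s 1 ->
    tau `]-oo, s]%classic = (2^-1 * (1 + w^`()%classic s))%:E.

Definition is_rayleigh_measure (R : realType) (a b : R)
    (tau : {charge set (measurableTypeR R) -> \bar R}) : Prop :=
  exists w : R -> R, diagram_on a b w /\ rayleigh_measure_of w tau.

(* The integral against a signed measure is the difference of the integrals
   against the two parts of its Jordan decomposition; that decomposition does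
   not depend on the Hahn decomposition picked by cid. *)
Definition charge_integral d (T : measurableType d) (R : realType)
    (nu : {charge set T -> \bar R}) (D : set T) (f : T -> R) : R :=
  let P := cid (Hahn_decomposition nu) in
  let N := cid (projT2 P) in
  \int[jordan_pos (projT2 N)]_(x in D) f x -
  \int[jordan_neg (projT2 N)]_(x in D) f x.

Definition charge_cintegral d (T : measurableType d) (R : realType)
    (nu : {charge set T -> \bar R}) (D : set T) (f : T -> R[i]) : R[i] :=
  charge_integral nu D (fun x => complex.Re (f x)) +i*
  charge_integral nu D (fun x => complex.Im (f x)).

(* Principal branch of the complex logarithm at a nonzero real y. For x < a
   the argument 1 / (1 - q^(x - s)) below is negative, so a real-valued
   logarithm would not do (the library's ln is 0 there). *)
Definition cln (R : realType) (y : R) : R[i] :=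
  ln `|y| +i* (if y < 0 then pi else 0).

Definition cexp (R : realType) (z : R[i]) : R[i] :=
  (expR (complex.Re z) * cos (complex.Im z)) +i*
  (expR (complex.Re z) * sin (complex.Im z)).

Definition q_markov_krein (R : realType) (a b q : R)
    (mu : probability (measurableTypeR R) R)
    (tau : {charge set (measurableTypeR R) -> \bar R}) : Prop :=
  forall x : R, x \notin `[a, b] ->
    (\int[mu]_(s in `[a, b]) (1 - q `^ (x - s))^-1)%:C =
    cexp (charge_cintegral tau `[a, b]%classic
            (fun s : R => cln (1 - q `^ (x - s))^-1)).

(* Main.v *)
Require Import Defs.
From HB Require Import structures.
From mathcomp Require Import all_boot all_order all_algebra.
From mathcomp Require Import all_classical all_reals all_analysis.
From mathcomp Require Import measurable_realfun complex ring lra zify.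

Set Implicit Arguments.
Unset Strict Implicit.
Unset Printing Implicit Defensive.

Import Order.TTheory GRing.Theory Num.Theory.
Import numFieldNormedType.Exports.

Local Open Scope classical_set_scope.
Local Open Scope ring_scope.

(** Put t = q^(-s) and z = q^x. For x > b the two sides of the identity are
    integrals of h(z t) with h(y) = 1/(1 - y), resp. h(y) = -ln(1 - y) after
    taking logarithms, so letting z -> 0 recovers all moments of t under mu,
    resp. all moments of positive order under tau. Moments determine a finite
    measure on a bounded interval, since the polynomials
    (1 - u^n)^(n * N_n) with N_n about r^(-n) tend boundedly to the indicator
    of u < r on [0, 1]. The moment of order 0 of tau, absent from the expansion
    of the logarithm, is tau [a, b] = 1: the only alternative is
    tau [a, b] = 0, for a diagram centred outside [a, b], and it is ruled out
    by the sign of the identity at a point x < a. *)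

(** * Polynomial cutoffs on the unit interval *)

Section cutoff.
Context {R : realType}.
Implicit Types r u x : R.

(** With [e = - ln u] one has [u ^+ n = expR (- (n e))], and the quadratic term of the exponential
    series gives n u^n <= 2 / (n e^2). The constant 4 in place of 2 pays for the passage from 1 / n
    to [harmonic n], which is 1 / (n + 1). *)
Lemma natmul_geometric_le u : 0 <= u -> u < 1 ->
  exists C, forall n, n%:R * u ^+ n <= C * harmonic n.
Proof.
rewrite le_eqVlt => /predU1P[<- _|u0 u1].
  exists 0 => -[|n]; first by rewrite !mul0r.
  by rewrite expr0n/= mulr0 mul0r.
have e0 : 0 < - ln u by rewrite oppr_gt0 ln_lt0 ?u0.
set e := - ln u in e0.
have K0 : 0 <= 4 / e ^+ 2 by rewrite divr_ge0// exprn_ge0// ltW.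
exists (4 / e ^+ 2) => -[|n]; first by rewrite mul0r mulr_ge0// /harmonic invr_ge0.
have ne0 : 0 < n.+1%:R * e by rewrite mulr_gt0.
rewrite -[u]lnK ?posrE// -expRM_natl -[ln u]opprK -/e mulrN expRN.
rewrite ler_pdivrMr ?expR_gt0//.
apply: (@le_trans _ _ (4 / e ^+ 2 * harmonic n.+1 * ((n.+1%:R * e) ^+ 2 / 2))).
  have -> : 4 / e ^+ 2 * harmonic n.+1 * ((n.+1%:R * e) ^+ 2 / 2) =
      (2 * n.+1%:R) / n.+2%:R * n.+1%:R :> R.
    rewrite /harmonic/=; have : n.+2%:R != 0 :> R by [].
    move: n.+1%:R n.+2%:R => N H H0; field.
    by rewrite H0 gt_eqF.
  by rewrite ler_peMl// ler_pdivlMr// mul1r -natrM ler_nat; lia.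
rewrite ler_wpM2l//; first by rewrite (mulr_ge0 K0)// invr_ge0.
by rewrite (le_trans _ (expR_ge1Dxn 1 (ltW ne0)))// lerDr.
Qed.

Lemma bernoulli_inequality x n : 0 <= x -> x <= 1 -> 1 - n%:R * x <= (1 - x) ^+ n.
Proof.
move=> x0 x1; elim: n => [|n IH]; first by rewrite mul0r subr0.
rewrite exprS (@le_trans _ _ ((1 - x) * (1 - n%:R * x)))//; last first.
  by rewrite ler_wpM2l// subr_ge0.
rewrite -natr1 -subr_ge0.
rewrite (_ : _ - _ = n%:R * (x * x)); last by ring.
by rewrite mulr_ge0// mulr_ge0.
Qed.

Definition cutoff_exponent r n := (n * (Num.truncn (r ^- n)).+1)%N.

(* With N about r^-n, the quantity N u^n tends to 0 or to infinity according
   to whether u < r or u > r; the extra factor n also settles u = r. *)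
Lemma cvg_cutoff r u : 0 < r -> r <= 1 -> 0 <= u -> u <= 1 ->
  (1 - u ^+ n) ^+ cutoff_exponent r n @[n --> \oo] --> ((u < r)%R%:R : R).
Proof.
move=> r0 r1 u0 u1.
have un0 n : 0 <= u ^+ n by rewrite exprn_ge0.
have un1 n : u ^+ n <= 1 by rewrite exprn_ile1.
have [ur|ru] := ltP u r.
- have [||C hC] := @natmul_geometric_le (u / r).
  + by rewrite divr_ge0// ltW.
  + by rewrite ltr_pdivrMr// mul1r.
  apply: (@squeeze_cvgr _ _ _ _ (fun n => 1 - 2 * (C * harmonic n)) (fun=> 1)).
  + apply: nearW => n; rewrite exprn_ile1 ?andbT ?subr_ge0 ?gerBl//.
    apply: le_trans (bernoulli_inequality _ (un0 n) (un1 n)).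
    rewrite lerB// (le_trans _ (ler_wpM2l _ (hC n)))//.
    rewrite /cutoff_exponent natrM -mulrA [leRHS]mulrCA ler_wpM2l//.
    rewrite expr_div_n [leRHS]mulrCA [leRHS]mulrC ler_wpM2r//.
    (* Since [r ^- n] is at least 1, adding 1 to its integer part at most doubles it: hence the 2 in
       the lower bound. *)
    have rn1 : 1 <= r ^- n by rewrite invf_ge1 ?exprn_gt0// exprn_ile1// ltW.
    rewrite -natr1 mulr_natl mulr2n lerD// truncn_le.
    by rewrite (le_trans _ rn1).
  + rewrite -[X in _ --> X]subr0 -[X in _ - X](mulr0 2) -(mulr0 C).
    apply: cvgB; first exact: cvg_cst.
    by do 2 (apply: cvgM; first exact: cvg_cst); exact: cvg_harmonic.
  + exact: cvg_cst.
- apply: (@squeeze_cvgr _ _ _ _ (fun=> 0) harmonic); last 2 first.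
  + exact: cvg_cst.
  + exact: cvg_harmonic.
  apply: nearW => n; rewrite exprn_ge0 ?subr_ge0//=.
  (* From 1 - x <= exp(-x), it suffices that the exponent times [u ^+ n] be at least n; this holds
     because the integer factor exceeds [r ^- n] and [u ^+ n >= r ^+ n]. *)
  apply: (@le_trans _ _ (expR (- u ^+ n) ^+ cutoff_exponent r n)).
    by rewrite lerXn2r ?nnegrE ?subr_ge0// ?expR_ge0// expR_ge1Dx.
  rewrite -expRM_natl mulrN expRN /harmonic lef_pV2 ?posrE ?expR_gt0//.
  apply: le_trans (expR_ge1Dx _); rewrite -nat1r lerD2l.
  rewrite /cutoff_exponent natrM -mulrA ler_peMr//.
  apply: (@le_trans _ _ (r ^- n * r ^+ n)).
    by rewrite mulVf// gt_eqF// exprn_gt0.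
  rewrite ler_pM ?exprn_ge0 ?invr_ge0 ?exprn_ge0 ?(ltW r0)//.
    by rewrite ltW// truncnS_gt.
  by rewrite lerXn2r ?nnegrE// ltW.
Qed.

End cutoff.

(** * Moments and the difference of two finite measures *)

Section integral_difference.
Context d (T : measurableType d) (R : realType) (D : set T).
Hypothesis mD : measurable D.

Definition bounded_mfun (f : T -> R) : Prop :=
  measurable_fun D f /\ exists K, forall x, D x -> `|f x| <= K.

Lemma bounded_mfun_cst c : bounded_mfun (fun=> c).
Proof. by split; [exact: measurable_cst|exists `|c|]. Qed.

Lemma bounded_mfunD f g :
  bounded_mfun f -> bounded_mfun g -> bounded_mfun (fun x => f x + g x).
Proof.
move=> [mf [K fK]] [mg [L gL]]; split; first exact: measurable_funD.
by exists (K + L) => x Dx; rewrite (le_trans (ler_normD _ _))// lerD ?fK ?gL.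
Qed.

Lemma bounded_mfunM f g :
  bounded_mfun f -> bounded_mfun g -> bounded_mfun (fun x => f x * g x).
Proof.
move=> [mf [K fK]] [mg [L gL]]; split; first exact: measurable_funM.
by exists (K * L) => x Dx; rewrite normrM ler_pM// ?fK ?gL.
Qed.

Lemma bounded_mfunX f n : bounded_mfun f -> bounded_mfun (fun x => f x ^+ n).
Proof.
move=> bf; elim: n => [|n IH]; first exact: bounded_mfun_cst.
rewrite (_ : (fun _ => _) = (fun x => f x * f x ^+ n)); last first.
  by apply/funext => x; rewrite exprS.
exact: bounded_mfunM.
Qed.

Lemma bounded_mfun_sum n (f : nat -> T -> R) :
  (forall k, (k < n)%N -> bounded_mfun (f k)) ->
  bounded_mfun (fun x => \sum_(k < n) f k x).
Proof.
elim: n => [_|n IH bf].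
  rewrite (_ : (fun _ => _) = fun=> 0); first exact: bounded_mfun_cst.
  by apply/funext => x; rewrite big_ord0.
rewrite (_ : (fun _ => _) = (fun x => \sum_(k < n) f k x + f n x)); last first.
  by apply/funext => x; rewrite big_ord_recr.
by apply: bounded_mfunD; [apply: IH => k /ltnW kn; apply: bf|exact: bf].
Qed.

Lemma bounded_mfun_integrable (P : {measure set T -> \bar R}) f :
  (P D < +oo)%E -> bounded_mfun f -> P.-integrable D (EFin \o f).
Proof.
move=> PD [mf [K fK]]; apply: measurable_bounded_integrable => //.
exists K; split; first exact: num_real.
by move=> L KL x /= Dx; rewrite (le_trans (fK _ Dx))// ltW.
Qed.

Variables P Q : {measure set T -> \bar R}.
Hypotheses (PD : (P D < +oo)%E) (QD : (Q D < +oo)%E).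

Definition integral_diff (f : T -> R) : R :=
  \int[P]_(x in D) f x - \int[Q]_(x in D) f x.

Local Notation L := integral_diff.

Lemma integral_diffD f g : bounded_mfun f -> bounded_mfun g ->
  L (fun x => f x + g x) = L f + L g.
Proof.
move=> bf bg; rewrite /L !RintegralD//; try exact: bounded_mfun_integrable.
by rewrite opprD addrACA.
Qed.

Lemma integral_diffZ c f : bounded_mfun f -> L (fun x => c * f x) = c * L f.
Proof.
move=> bf; rewrite /L !RintegralZl//; try exact: bounded_mfun_integrable.
by rewrite mulrBr.
Qed.

Lemma integral_diff_sum n (f : nat -> T -> R) :
  (forall k, (k < n)%N -> bounded_mfun (f k)) ->
  L (fun x => \sum_(k < n) f k x) = \sum_(k < n) L (f k).
Proof.
elim: n => [_|n IH bf].
  rewrite big_ord0 (_ : (fun _ => _) = fun=> 0).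
    by rewrite /L !Rintegral_cst// !mul0r subrr.
  by apply/funext => x; rewrite big_ord0.
rewrite big_ord_recr (_ : (fun _ => _) =
  (fun x => \sum_(k < n) f k x + f n x)); last first.
  by apply/funext => x; rewrite big_ord_recr.
rewrite integral_diffD ?IH//; first by move=> k /ltnW kn; exact: bf.
- by apply: bounded_mfun_sum => k /ltnW kn; exact: bf.
- exact: bf.
Qed.

Lemma le_norm_integral_diff f K : bounded_mfun f ->
  (forall x, D x -> `|f x| <= K) ->
  `|L f| <= K * (fine (P D) + fine (Q D)).
Proof.
move=> bf fK.
have bd (m : {measure set T -> \bar R}) : (m D < +oo)%E ->
    `|\int[m]_(x in D) f x| <= K * fine (m D).
  move=> mDoo; rewrite -Rintegral_cst//.
  have intf := bounded_mfun_integrable mDoo bf.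
  apply: le_trans; first exact: le_normr_Rintegral.
  apply: le_Rintegral => //; first exact: integrable_norm.
  exact/bounded_mfun_integrable/bounded_mfun_cst.
by rewrite mulrDr (le_trans (ler_normB _ _))// lerD// bd.
Qed.

Lemma eq_integral_diff f g : (forall x, D x -> f x = g x) -> L f = L g.
Proof.
by move=> fg; rewrite /L; congr (_ - _); apply: eq_Rintegral => x /set_mem /fg.
Qed.

(* Induction on the order: once the first n moments agree, the n-th
   coefficient of the expansion in z of the vanishing difference
   \int h (z t) dP - \int h (z t) dQ is al n times the difference of the n-th
   moments. *)
Lemma moments_eq_of_expansion (h : R -> R) (t : T -> R) (M : R)
    (al : nat -> R) :
  0 < M -> measurable_fun D t -> (forall x, D x -> 0 <= t x <= M) ->
  measurable_fun setT h -> (forall k, al k.+1 != 0) ->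
  (forall n, exists C, forall y, 0 <= y <= 2^-1 ->
     `|h y - \sum_(k < n) al k * y ^+ k| <= C * y ^+ n) ->
  P D = Q D ->
  (forall z, 0 < z -> z * M <= 2^-1 -> L (fun x => h (z * t x)) = 0) ->
  forall k, L (fun x => t x ^+ k) = 0.
Proof.
move=> M0 mt tM mh al0 hC PQ Lh; elim/ltn_ind => -[_|n IH].
  (* Order 0 comes from the equality of masses and not from the expansion: [al 0] may vanish, as it
     does for the logarithm. *)
  by rewrite /L !Rintegral_cst// PQ subrr.
have bt : bounded_mfun t.
  split=> //; exists M => x /tM/andP[t0 ?]; by rewrite ger0_norm.
have btX k : bounded_mfun (fun x => t x ^+ k) by exact: bounded_mfunX.
have [C hCn] := hC n.+2.
set B := fine (P D) + fine (Q D).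
(* Truncating after order n + 1 leaves an error of order z^(n+2); division by z^(n+1) leaves one
   factor z, which can be made arbitrarily small. *)
have key z : 0 < z -> z * M <= 2^-1 ->
    `|al n.+1 * L (fun x => t x ^+ n.+1)| <= z * (`|C| * M ^+ n.+2 * B).
  move=> z0 zM.
  pose p x := \sum_(k < n.+2) al k * (z * t x) ^+ k.
  have bal k : bounded_mfun (fun x => al k * (z * t x) ^+ k).
    apply: bounded_mfunM; first exact: bounded_mfun_cst.
    by apply/bounded_mfunX/bounded_mfunM => //; exact: bounded_mfun_cst.
  have bp : bounded_mfun p.
    by apply: (bounded_mfun_sum (f := fun k x => al k * (z * t x) ^+ k)).
  have E0 x : D x -> `|h (z * t x) - p x| <= `|C| * (z * M) ^+ n.+2.
    move=> /tM/andP[t0 tM'].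
    have zt0 : 0 <= z * t x by rewrite mulr_ge0// ltW.
    rewrite (le_trans (hCn _ _))//.
      by rewrite zt0 (le_trans _ zM)// ler_pM2l.
    apply: (@le_trans _ _ (`|C| * (z * t x) ^+ n.+2)).
      by rewrite ler_wpM2r ?exprn_ge0// ler_norm.
    by rewrite ler_wpM2l// lerXn2r ?nnegrE// ?ler_pM2l// mulr_ge0// ltW.
  have mhz : measurable_fun D (fun x => h (z * t x)).
    apply: measurableT_comp => //.
    by apply: measurable_funM => //; exact: measurable_cst.
  have bE : bounded_mfun (fun x => h (z * t x) - p x).
    split; first by apply: measurable_funB => //; case: bp.
    by exists (`|C| * (z * M) ^+ n.+2).
  have Lp : L p = al n.+1 * z ^+ n.+1 * L (fun x => t x ^+ n.+1).
    have LX k : L (fun x => al k * (z * t x) ^+ k) =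
        al k * z ^+ k * L (fun x => t x ^+ k).
      rewrite -integral_diffZ//; apply: eq_integral_diff => x _.
      by rewrite exprMn mulrA.
    rewrite (integral_diff_sum (f := fun k x => al k * (z * t x) ^+ k))//.
    rewrite big_ord_recr/= big1 ?add0r// => k _.
    by rewrite LX IH ?mulr0.
  have LE : L (fun x => h (z * t x) - p x) = - L p.
    have : L (fun x => (h (z * t x) - p x) + p x) = 0.
      rewrite -[RHS](Lh z z0 zM); apply: eq_integral_diff => x _.
      by rewrite subrK.
    by rewrite integral_diffD// => /eqP; rewrite addr_eq0 => /eqP.
  have := le_norm_integral_diff bE E0; rewrite LE normrN Lp -/B.
  rewrite -mulrA mulrCA normrM (gtr0_norm (exprn_gt0 _ z0)) exprMn.
  rewrite [in leRHS]exprSr => H.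
  rewrite -(ler_pM2l (exprn_gt0 n.+1 z0)) (le_trans H)// le_eqVlt.
  by apply/orP; left; apply/eqP; ring.
have [->//|Ln0] := eqVneq (L (fun x => t x ^+ n.+1)) 0.
have a0 : 0 < `|al n.+1 * L (fun x => t x ^+ n.+1)|.
  by rewrite normr_gt0 mulf_neq0.
set A := `|_| in a0 key; set K := `|C| * _ * B in key.
have B0 : 0 <= B by rewrite addr_ge0// fine_ge0.
have K0 : 0 <= K by rewrite /K mulr_ge0// mulr_ge0// exprn_ge0// ltW.
(* The first entry keeps [z * M] below one half; the second gives [z * (K + 1) <= A / 2],
   contradicting [key]. The [+ 1] keeps the denominator positive. *)
pose z := Num.min ((2 * M)^-1) (A / (2 * (K + 1))).
have z0 : 0 < z.
  by rewrite lt_min invr_gt0 mulr_gt0//= divr_gt0// mulr_gt0// ltr_wpDl.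
have zM : z * M <= 2^-1.
  apply: (@le_trans _ _ ((2 * M)^-1 * M)).
    by rewrite ler_pM2r// ge_min lexx.
  by rewrite invfM -mulrA mulVf ?mulr1// gt_eqF.
have zA : z <= A / (2 * (K + 1)) by rewrite ge_min lexx orbT.
have := key z z0 zM; rewrite leNgt => /negP; case.
apply: (@le_lt_trans _ _ (A / (2 * (K + 1)) * (K + 1))).
  by rewrite ler_pM ?(ltW z0)// lerDl.
rewrite invfM mulrA -mulrA mulVf ?mulr1; last by rewrite gt_eqF// ltr_wpDl.
by rewrite ltr_pdivrMr// ltr_pMr// ltrDl.
Qed.

Lemma integral_diff_horner (t : T -> R) (p : {poly R}) : bounded_mfun t ->
  (forall k, L (fun x => t x ^+ k) = 0) -> L (fun x => p.[t x]) = 0.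
Proof.
move=> bt Lt.
have bX k : bounded_mfun (fun x => p`_k * t x ^+ k).
  by apply: bounded_mfunM; [exact: bounded_mfun_cst|exact: bounded_mfunX].
under eq_fun do rewrite horner_coef.
rewrite (integral_diff_sum (f := fun k x => p`_k * t x ^+ k))//.
rewrite big1// => k _.
by rewrite integral_diffZ ?Lt ?mulr0//; exact: bounded_mfunX.
Qed.

(** The cutoffs [g n] are polynomials in [t], so [P] and [Q] integrate them equally. They are
    bounded by 1 and tend to the indicator of [t < c], so dominated convergence carries the equality
    to the limit. *)
Lemma measure_eq_of_moments (t : T -> R) (M c : R) : 0 < M -> 0 < c ->
  measurable_fun D t -> (forall x, D x -> 0 <= t x <= M) ->
  (forall k, L (fun x => t x ^+ k) = 0) ->
  P (D `&` [set x | t x < c]) = Q (D `&` [set x | t x < c]).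
Proof.
move=> M0 c0 mt tM Lt; set A := D `&` _.
have bt : bounded_mfun t.
  by split=> //; exists M => x /tM/andP[t0 ?]; rewrite ger0_norm.
have mA : measurable A.
  rewrite (_ : A = D `&` t @^-1` `]-oo, c[%classic); last first.
    by apply/seteqP; split=> x /=; rewrite in_itv.
  by apply: mt => //; exact: measurable_itv.
(* Dividing by the larger of [M] and [c] puts [t x / m] in [0, 1] and also ensures [r <= 1], both
   required by [cvg_cutoff]. *)
pose m := Num.max M c.
have m0 : 0 < m by rewrite lt_max M0.
pose r := c / m.
have r0 : 0 < r by rewrite divr_gt0.
have r1 : r <= 1 by rewrite ler_pdivrMr// mul1r le_max lexx orbT.
pose g n x := (1 - (t x / m) ^+ n) ^+ cutoff_exponent r n.
have u01 x : D x -> 0 <= t x / m <= 1.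
  move=> /tM/andP[t0 t1]; rewrite divr_ge0 ?(ltW m0)//= ler_pdivrMr// mul1r.
  by rewrite (le_trans t1)// le_max lexx.
have g01 n x : D x -> `|g n x| <= 1.
  move=> /u01/andP[x0 x1].
  have xn1 : (t x / m) ^+ n <= 1 by rewrite exprn_ile1.
  rewrite ger0_norm ?exprn_ge0 ?subr_ge0// exprn_ile1 ?subr_ge0//.
  by rewrite gerBl exprn_ge0.
pose p n : {poly R} :=
  (1 - ((m^-1)%:P * 'X) ^+ n) ^+ cutoff_exponent r n.
have pE n x : (p n).[t x] = g n x.
  by rewrite /p /g !hornerE [m^-1 * _]mulrC.
have bg n : bounded_mfun (g n).
  split; last by exists 1 => x; exact: g01.
  apply: measurable_funX; apply: measurable_funB; first exact: measurable_cst.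
  by apply: measurable_funX; apply: measurable_funM => //; exact: measurable_cst.
have cvg_int (mu : {measure set T -> \bar R}) : (mu D < +oo)%E ->
    (\int[mu]_(x in D) (g n x)%:E @[n --> \oo] --> mu A)%E.
  move=> muD.
  have -> : mu A = (\int[mu]_(x in D) (\1_A x)%:E)%E.
    by rewrite integral_indic// setIidl//; exact: subIsetl.
  apply: (@dominated_cvg _ _ _ _ _ _ _ _ (fun=> 1%:E)) => //.
  - by move=> n; apply/measurable_EFinP; case: (bg n).
  - move=> x Dx; apply: cvg_EFin; first exact: nearW.
    have -> : \1_A x = ((t x / m < r)%R%:R : R).
      rewrite indicE /r ltr_pM2r ?invr_gt0//; congr (_%:R); congr nat_of_bool.
      by apply/idP/idP => [/set_mem[]//|h]; apply/mem_set.
    by have /andP[? ?] := u01 _ Dx; exact: cvg_cutoff.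
  - exact: (bounded_mfun_integrable muD (bounded_mfun_cst 1)).
rewrite -(cvg_lim _ (cvg_int _ PD))// -(cvg_lim _ (cvg_int _ QD))//.
congr (lim (_ @ \oo)); apply/funext => n.
have : L (g n) = 0.
  rewrite -[RHS](integral_diff_horner (p n) bt Lt).
  by apply: eq_integral_diff => x _; rewrite pE.
move/subr0_eq; rewrite /Rintegral => h.
rewrite -[LHS]fineK ?h ?fineK//;
  by apply: integrable_fin_num => //; exact: bounded_mfun_integrable.
Qed.

End integral_difference.

(** * Taylor bounds for the two kernels *)

Section expansions.
Context {R : realType}.
Implicit Types y : R.

Lemma measurable_invr : measurable_fun [set: R] (@GRing.inv R).
Proof.
(* Writing the inverse as x |x|^(-2) reduces the claim to real powers; at 0 both sides are 0. *)
rewrite (_ : @GRing.inv R = fun x => x * (`|x| `^ (-1)) ^+ 2); last first.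
  apply/funext => x; rewrite powR_inv1// -normfV real_normK ?num_real//.
  have [->|x0] := eqVneq x 0; first by rewrite mul0r invr0.
  by rewrite expr2 mulrA divff// mul1r.
apply: measurable_funM => //; apply: measurable_funX.
exact: measurableT_comp (measurable_powR _) (@normr_measurable _ _).
Qed.

(** The remainder is exactly [y ^+ n / (1 - y)], and [1 - y] is at least one half, whence the 2. The
    factor [1 *] fits the shape [al k * y ^+ k]. *)
Lemma geometric_expansion n y : 0 <= y <= 2^-1 ->
  `|(1 - y)^-1 - \sum_(k < n) 1 * y ^+ k| <= 2 * y ^+ n.
Proof.
move=> /andP[y0 y2]; under eq_bigr do rewrite mul1r.
have y1 : 2^-1 <= 1 - y by lra.
have y1' : 0 < 1 - y by lra.
have -> : (1 - y)^-1 - \sum_(k < n) y ^+ k = y ^+ n / (1 - y).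
  have := subrX1 y n; rewrite -opprB -[y - 1]opprB mulNr => /oppr_inj yn.
  apply: (mulIf (lt0r_neq0 y1')).
  rewrite mulrBl mulVf ?lt0r_neq0// [_ * (1 - y)]mulrC -yn divfK ?lt0r_neq0//.
  by rewrite opprB addrC subrK.
rewrite ger0_norm ?divr_ge0 ?exprn_ge0 ?(ltW y1')// mulrC ler_wpM2r ?exprn_ge0//.
by rewrite -[leRHS]invrK lef_pV2 ?posrE.
Qed.

(** Mean value theorem for -ln(1 - x) minus its partial sum, whose derivative telescopes to x^n / (1
    - x), at most 2 y^n on [0, y]. The index k = 0 contributes nothing, because the inverse of 0 is
    0. *)
Lemma log_expansion n y : 0 <= y <= 2^-1 ->
  `|ln `|(1 - y)^-1| - \sum_(k < n.+1) k%:R^-1 * y ^+ k| <= 2 * y ^+ n.+1.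
Proof.
move=> /andP[y0 y2].
pose f (x : R) : R := - ln (1 - x) - \sum_(k < n) k.+1%:R^-1 * x ^+ k.+1.
pose df (x : R) : R := x ^+ n / (1 - x).
have -> : ln `|(1 - y)^-1| - \sum_(k < n.+1) k%:R^-1 * y ^+ k = f y - f 0.
  have y1 : 0 < 1 - y by lra.
  rewrite big_ord_recl/= invr0 mul0r add0r gtr0_norm ?invr_gt0// lnV ?posrE//.
  have f0 : f 0 = 0.
    rewrite /f subr0 ln1 oppr0 sub0r big1 ?oppr0// => k _.
    by rewrite expr0n mulr0.
  by rewrite f0 subr0.
have fd (x : R) : 0 <= x <= 2^-1 -> is_derive x 1 f (df x).
  move=> /andP[x0 x2].
  have x1 : 0 < 1 - x by lra.
  have -> : f = - (@ln R \o (cst 1 - id)) -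
      \sum_(k < n) (k.+1%:R^-1 \*: ((@id R) ^+ k.+1)).
    apply/funext => z; rewrite /f !fctE/= fct_sumE.
    by congr (_ - _); apply: eq_bigr => k _; rewrite !fctE.
  have dln : is_derive x 1 (@ln R \o (cst 1 - id)) ((1 - x)^-1 * (0 - 1)).
    by apply: is_derive1_comp; exact: is_derive1_ln.
  have dX (k : 'I_n) : is_derive x 1 (k.+1%:R^-1 \*: ((@id R) ^+ k.+1)) (x ^+ k).
    apply: is_derive_eq.
    by rewrite /GRing.scale/= mulr1 mulrA mulVf// mul1r.
  apply: is_derive_eq.
  have := subrX1 x n; rewrite -opprB -[x - 1]opprB mulNr => /oppr_inj xn.
  apply: (mulIf (lt0r_neq0 x1)); rewrite /df divfK ?lt0r_neq0//.
  rewrite mulrBl [X in _ - X]mulrC -xn sub0r mulrN1 opprK.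
  by rewrite mulVf ?lt0r_neq0// opprB addrC subrK.
have [||c] := @MVT_segment _ f df _ _ y0.
- by move=> x; rewrite in_itv/= => /andP[x0 xy]; apply: fd; lra.
- apply: derivable_within_continuous => x; rewrite in_itv/= => /andP[x0 xy].
  by have [] : is_derive x 1 f (df x) by apply: fd; lra.
rewrite in_itv/= => /andP[c0 cy] ->.
have c1 : 2^-1 <= 1 - c by lra.
have c1' : 0 < 1 - c by lra.
rewrite subr0 ger0_norm; last first.
  by rewrite mulr_ge0// divr_ge0 ?exprn_ge0// ltW.
rewrite exprSr mulrA ler_wpM2r// /df mulrC ler_pM// ?invr_ge0 ?exprn_ge0 ?(ltW c1')//.
  by rewrite -[leRHS]invrK lef_pV2 ?posrE.
by rewrite lerXn2r ?nnegrE.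
Qed.

End expansions.

(** * Continuity of charges and uniqueness from rays *)

Section charges.
Context {R : realType}.

(** Hides the chosen Hahn decomposition: what matters later is only that the charge and its integral
    are differences for the same two finite measures. *)
Lemma charge_integral_jordan d (T : measurableType d)
    (nu : {charge set T -> \bar R}) :
  exists p n : {finite_measure set T -> \bar R},
    (forall A, measurable A -> nu A = (p A - n A)%E) /\
    forall D f, charge_integral nu D f =
      \int[p]_(x in D) f x - \int[n]_(x in D) f x.
Proof.
rewrite /charge_integral.
set N := projT2 (cid (projT2 (cid (Hahn_decomposition nu)))).
exists (jordan_pos N), (jordan_neg N); split=> // A mA.
by rewrite [LHS](jordan_decomp N mA) /cadd/= cscaleN1.
Qed.

Lemma charge_nondecreasing_cvg d (T : measurableType d)
    (nu : {charge set T -> \bar R}) (F : (set T)^nat) :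
  (forall i, measurable (F i)) -> nondecreasing_seq F ->
  nu \o F @ \oo --> nu (\bigcup_n F n).
Proof.
move=> mF ndF; have [p [n [nuE _]]] := charge_integral_jordan nu.
have mU : measurable (\bigcup_n F n) by exact: bigcupT_measurable.
rewrite nuE// (_ : nu \o F = fun i => (p (F i) - n (F i))%E); last first.
  by apply/funext => i /=; rewrite nuE.
apply: cvgeB; first by rewrite fin_num_adde_defr ?fin_num_measure.
- exact: nondecreasing_cvg_mu.
- exact: nondecreasing_cvg_mu.
Qed.

Lemma charge_nonincreasing_cvg d (T : measurableType d)
    (nu : {charge set T -> \bar R}) (F : (set T)^nat) :
  (forall i, measurable (F i)) -> nonincreasing_seq F ->
  nu \o F @ \oo --> nu (\bigcap_n F n).
Proof.
move=> mF niF; have [p [n [nuE _]]] := charge_integral_jordan nu.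
have mI : measurable (\bigcap_n F n) by exact: bigcapT_measurable.
rewrite nuE// (_ : nu \o F = fun i => (p (F i) - n (F i))%E); last first.
  by apply/funext => i /=; rewrite nuE.
apply: cvgeB; first by rewrite fin_num_adde_defr ?fin_num_measure.
- by apply: nonincreasing_cvg_mu => //; rewrite ltey_eq fin_num_measure.
- by apply: nonincreasing_cvg_mu => //; rewrite ltey_eq fin_num_measure.
Qed.

Implicit Types (nu : {charge set (measurableTypeR R) -> \bar R}) (y e : R).

(** Continuity from below along the closed rays ending at y - 1/(n+1), whose values are eventually
    [v]: this is the left limit of the distribution function. *)
Lemma charge_ray_left nu y e v : 0 < e ->
  (forall s, y - e < s < y -> nu `]-oo, s]%classic = v) ->
  nu `]-oo, y[%classic = v.
Proof.
move=> e0 nuv; pose F n := `]-oo, y - n.+1%:R^-1]%classic.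
have -> : `]-oo, y[%classic = \bigcup_n F n.
  apply/seteqP; split => s /=; rewrite in_itv/=.
    move=> sy; exists (Num.truncn (y - s)^-1) => //.
    rewrite /F/= in_itv/= lerBrDr -lerBrDl -[leRHS]invrK.
    rewrite lef_pV2 ?posrE ?invr_gt0 ?subr_gt0//.
    exact/ltW/truncnS_gt.
  move=> [n _]; rewrite /F/= in_itv/= => /le_lt_trans; apply.
  by rewrite ltrBlDr ltrDl invr_gt0.
have cF := @charge_nondecreasing_cvg _ _ nu F.
rewrite -(cvg_lim _ (cF _ _))//; last 2 first.
- by move=> i; exact: measurable_itv.
- move=> m n mn; apply/subsetPset => s; rewrite /F/= !in_itv/= => /le_trans.
  by apply; rewrite lerB// lef_pV2 ?posrE// ler_nat.
apply/cvg_lim => //; apply: cvg_near_cst.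
have := near_infty_natSinv_lt (PosNum e0); apply: filterS => n /= ne.
by apply: nuv; rewrite ltrD2l ltrN2 ne/= ltrBlDr ltrDl invr_gt0.
Qed.

Lemma charge_ray_right nu y e v : 0 < e ->
  (forall s, y < s < y + e -> nu `]-oo, s]%classic = v) ->
  nu `]-oo, y]%classic = v.
Proof.
move=> e0 nuv; pose F n := `]-oo, y + n.+1%:R^-1]%classic.
rewrite (itvNycEbigcap false).
have cF := @charge_nonincreasing_cvg _ _ nu F.
rewrite -(cvg_lim _ (cF _ _))//; last 2 first.
- by move=> i; exact: measurable_itv.
- move=> m n mn; apply/subsetPset => s; rewrite /F/= !in_itv/= => /le_trans.
  by apply; rewrite lerD// lef_pV2 ?posrE// ler_nat.
apply/cvg_lim => //; apply: cvg_near_cst.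
have := near_infty_natSinv_lt (PosNum e0); apply: filterS => n /= ne.
by apply: nuv; rewrite ltrDl invr_gt0 ltr0Sn ltrD2l.
Qed.

(** Open rays are stable under intersection and generate the Borel sets, and those with natural
    endpoints exhaust the line, so uniqueness of measures applies. *)
Lemma measure_eq_of_rays (P Q : {measure set (measurableTypeR R) -> \bar R}) :
  (forall y, (P `]-oo, y[%classic < +oo)%E) ->
  (forall y, P `]-oo, y[%classic = Q `]-oo, y[%classic) ->
  forall A, measurable A -> P A = Q A.
Proof.
move=> Pfin PQ A mA.
apply: (@measure_unique _ R (measurableTypeR R) (@RGenInftyO.G R)
  (fun n => `]-oo, n%:R[%classic)) => //.
- exact: RGenInftyO.measurableE.
- move=> _ _ [x ->] [y ->]; exists (Num.min x y).
  by apply/seteqP; split => s /=; rewrite !in_itv/= lt_min => /andP.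
- by move=> n; exists n%:R.
- apply/seteqP; split => // s _; exists (Num.truncn s).+1 => //=.
  by rewrite in_itv/= truncnS_gt.
- by move=> _ [y ->].
Qed.

End charges.

(** * Total mass of a Rayleigh measure *)

Section rayleigh.
Context {R : realType}.
Implicit Types (tau : {charge set (measurableTypeR R) -> \bar R}) (a b : R).

(** Near such a point [w] is affine of slope 1 or -1, so (1 + w') / 2 is 1 or 0. The centre may lie
    outside [a, b], where it is a kink of [w]; hence [s != s0]. *)
Lemma rayleigh_ray a b w tau (s0 : R) :
  (forall s, s \notin `[a, b] -> w s = `|s - s0|) ->
  rayleigh_measure_of w tau ->
  forall s, s \notin `[a, b] -> s != s0 ->
  tau `]-oo, s]%classic = ((s0 < s)%R%:R : R)%:E.
Proof.
move=> ws tauw s sab ss0.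
pose sg : R := if s0 < s then 1 else -1.
have near_s : \forall t \near s, t \notin `[a, b] /\ `|t - s0| = sg * (t - s0).
  have outside : \forall t \near s, t \notin `[a, b].
    move: sab; rewrite in_itv/= negb_and -!ltNge => /orP[sa|bs].
      near=> t; rewrite in_itv/= negb_and -!ltNge; apply/orP; left.
      by near: t; exact: lt_nbhsl.
    near=> t; rewrite in_itv/= negb_and -!ltNge; apply/orP; right.
    by near: t; exact: lt_nbhsr.
  have side : \forall t \near s, `|t - s0| = sg * (t - s0).
    rewrite /sg; case: ltgtP ss0 => // [s0s|ss0'] _.
      near=> t; rewrite mul1r gtr0_norm// subr_gt0.
      by near: t; exact: lt_nbhsr.
    near=> t; rewrite mulN1r ltr0_norm// subr_lt0.
    by near: t; exact: lt_nbhsl.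
  by near=> t; split; near: t.
have dg : is_derive s (1 : R) (sg \*: ((@id R) - cst s0)) (sg *: (1 - 0)).
  by apply: is_deriveZ; apply: is_deriveB.
have dw : is_derive s (1 : R) w sg.
  apply: (@near_eq_is_derive _ _ _ (sg \*: (@id R - cst s0))).
    by apply: filterS near_s => t [/ws -> ->].
  by apply: is_derive_eq; rewrite subr0 /GRing.scale/= mulr1.
rewrite tauw; last by case: dw.
rewrite derive1E derive_val /sg; case: ltP => _; congr (_%:E).
  by rewrite (_ : 1 + 1 = 2)// mulVf.
by rewrite subrr mulr0.
Unshelve. all: by end_near. Qed.

(** The mass is the jump of the distribution function from its left limit at [a] to its value at
    [b]. If the centre lies left of [a] both are 1, if right of [b] both are 0, and otherwise they
    are 0 and 1. *)
Lemma rayleigh_mass a b tau : a < b -> is_rayleigh_measure a b tau ->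
  tau `[a, b]%classic = 0%E \/
  [/\ tau `[a, b]%classic = 1%E,
      forall y, y <= a -> tau `]-oo, y[%classic = 0%E &
      forall y, b < y -> tau `]-oo, y[%classic = 1%E].
Proof.
move=> ab [w [[_ [s0 ws]] tauw]].
have ray := rayleigh_ray ws tauw.
have rayl s : s < a -> s != s0 ->
    tau `]-oo, s]%classic = ((s0 < s)%R%:R : R)%:E.
  by move=> sa; apply: ray; rewrite in_itv/= negb_and -!ltNge sa.
have rayr s : b < s -> s != s0 ->
    tau `]-oo, s]%classic = ((s0 < s)%R%:R : R)%:E.
  by move=> sa; apply: ray; rewrite in_itv/= negb_and -!ltNge sa orbT.
have tauD : tau `[a, b]%classic =
    (tau `]-oo, b]%classic - tau `]-oo, a[%classic)%E.
  have -> : `[a, b]%classic = `]-oo, b]%classic `\` `]-oo, a[%classic.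
    apply/seteqP; split => s /=; rewrite !in_itv/=.
      by move=> /andP[as_ sb]; split=> //; rewrite ltNge as_.
    by move=> [-> /negP]; rewrite -leNgt => ->.
  rewrite chargeD; [|exact: measurable_itv|exact: measurable_itv].
  congr (_ - tau _)%E; apply/seteqP; split => s /=; rewrite !in_itv/=.
    by case.
  by move=> sa; split=> //; rewrite ltW// (lt_trans sa).
have [s0a|as0] := ltP s0 a.
  left; rewrite tauD.
  have -> : tau `]-oo, b]%classic = 1%E.
    apply: (@charge_ray_right _ _ _ 1) => // s /andP[bs _].
    have s0s : s0 < s by rewrite (lt_trans s0a)// (lt_trans ab).
    by rewrite rayr// ?gt_eqF// s0s.
  have -> : tau `]-oo, a[%classic = 1%E.
    apply: (@charge_ray_left _ _ _ (a - s0)); first by rewrite subr_gt0.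
    rewrite opprB addrC subrK => s /andP[s0s sa].
    by rewrite rayl// ?gt_eqF// s0s.
  by rewrite subee.
have rayl0 y : y <= a -> tau `]-oo, y[%classic = 0%E.
  move=> ya; apply: (@charge_ray_left _ _ _ 1) => // s /andP[_ sy].
  have ss0 : s < s0 by rewrite (lt_le_trans sy)// (le_trans ya).
  by rewrite rayl ?lt_eqF// ?(lt_le_trans sy)// ltNge (ltW ss0).
have [bs0|s0b] := ltP b s0.
  left; rewrite tauD rayl0// sube0.
  apply: (@charge_ray_right _ _ _ (s0 - b)); first by rewrite subr_gt0.
  rewrite addrC subrK => s /andP[bs ss0].
  by rewrite rayr ?lt_eqF// ltNge (ltW ss0).
right; split=> //.
  rewrite tauD rayl0// sube0.
  apply: (@charge_ray_right _ _ _ 1) => // s /andP[bs _].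
  have s0s : s0 < s by rewrite (le_lt_trans s0b).
  by rewrite rayr// ?gt_eqF// s0s.
move=> y yb; apply: (@charge_ray_left _ _ _ (y - b)).
  by rewrite subr_gt0.
rewrite opprB addrC subrK => s /andP[bs _].
have s0s : s0 < s by rewrite (le_lt_trans s0b).
by rewrite rayr// ?gt_eqF// s0s.
Qed.

End rayleigh.

(** * Comparing two charges through two positive measures *)

Lemma adde_eq_sube (R : realFieldType) (x y z t : \bar R) :
  x \is a fin_num -> y \is a fin_num -> z \is a fin_num -> t \is a fin_num ->
  (x + t = z + y)%E <-> (x - y = z - t)%E.
Proof.
case: x => // x; case: y => // y; case: z => // z; case: t => // t _ _ _ _.
by rewrite -!EFinN -!EFinD; split=> -[h]; congr (_%:E); lra.
Qed.

(* The difference of two charges is written as a difference of two positive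
   measures, p + n' and p' + n in terms of their Jordan decompositions. *)
Lemma charge_integral_diff d (T : measurableType d) (R : realType)
    (D : set T) (mD : measurable D) (nu nu' : {charge set T -> \bar R}) :
  exists P Q : {measure set T -> \bar R},
  [/\ (forall A, measurable A -> (P A < +oo)%E /\ (Q A < +oo)%E),
      (forall A, measurable A -> P A = Q A <-> nu A = nu' A) &
      forall f, bounded_mfun D f ->
        charge_integral nu D f - charge_integral nu' D f =
        integral_diff D P Q f].
Proof.
have [p [n [nuE intE]]] := charge_integral_jordan nu.
have [p' [n' [nuE' intE']]] := charge_integral_jordan nu'.
have fin (m : {finite_measure set T -> \bar R}) A : measurable A ->
    (m A < +oo)%E by move=> mA; rewrite ltey_eq fin_num_measure.
exists (measure_add p n'), (measure_add p' n); split.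
- by move=> A mA; split; rewrite [ltLHS]measure_addE lte_add_pinfty// fin.
- move=> A mA; rewrite [X in X = _]measure_addE [X in _ = X <-> _]measure_addE.
  by rewrite nuE// nuE'//; apply: adde_eq_sube; exact: fin_num_measure.
- move=> f bf; rewrite intE intE' /integral_diff.
  have addE (m1 m2 : {finite_measure set T -> \bar R}) :
      \int[measure_add m1 m2]_(x in D) f x =
      \int[m1]_(x in D) f x + \int[m2]_(x in D) f x.
    have i1 := bounded_mfun_integrable mD (fin m1 D mD) bf.
    have i2 := bounded_mfun_integrable mD (fin m2 D mD) bf.
    by rewrite /Rintegral integral_measure_add// fineD//;
      exact: integrable_fin_num.
  by rewrite !addE; lra.
Qed.

(** * Uniqueness for transforms in the variable q^(x - s) *)

Section q_transform.
Context {R : realType}.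
Variables (a b q : R).
Hypotheses (q0 : 0 < q) (q1 : q < 1).
Local Notation D := (`[a, b]%classic : set (measurableTypeR R)).

Lemma measurable_qpow (x : R) :
  measurable_fun (setT : set (measurableTypeR R)) (fun s : R => q `^ (x - s)).
Proof.
apply: (measurableT_comp (measurable_powRr _)).
by apply: measurable_funB => //; exact: measurable_cst.
Qed.

Lemma qpow_le (x s : R) : s <= b -> q `^ (x - s) <= q `^ (x - b).
Proof.
by move=> sb; apply: ger_powR; [rewrite q0 ltW|rewrite lerB].
Qed.

Lemma bounded_mfun_transform (h : R -> R) (C x : R) :
  measurable_fun setT h -> (forall y, 0 <= y <= 2^-1 -> `|h y| <= C) ->
  q `^ (x - b) <= 2^-1 -> bounded_mfun D (fun s : R => h (q `^ (x - s))).
Proof.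
move=> mh hC xb; split.
  by apply: measurable_funTS; apply: (measurableT_comp mh); exact: measurable_qpow.
exists C => s; rewrite /= in_itv/= => /andP[_ sb].
by apply: hC; rewrite powR_ge0 (le_trans (qpow_le x sb)).
Qed.

Lemma transform_determines_measure (h : R -> R) (al : nat -> R)
    (P Q : {measure set (measurableTypeR R) -> \bar R}) :
  measurable_fun setT h -> (forall k, al k.+1 != 0) ->
  (forall n, exists C, forall y, 0 <= y <= 2^-1 ->
     `|h y - \sum_(k < n) al k * y ^+ k| <= C * y ^+ n) ->
  (P D < +oo)%E -> (Q D < +oo)%E -> P D = Q D ->
  (forall x, q `^ (x - b) <= 2^-1 ->
    integral_diff D P Q (fun s : R => h (q `^ (x - s))) = 0) ->
  forall y, P (D `&` `]-oo, y[%classic) = Q (D `&` `]-oo, y[%classic).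
Proof.
move=> mh al0 hC PD QD PQ Lh y.
have mD : measurable D by exact: measurable_itv.
pose t (s : R) := q `^ (0 - s).
have mt : measurable_fun D t by apply: measurable_funTS; exact: measurable_qpow.
have tM s : D s -> 0 <= t s <= q `^ (0 - b).
  by rewrite /= in_itv/= => /andP[_ sb]; rewrite powR_ge0 qpow_le.
have M0 : 0 < q `^ (0 - b) by rewrite powR_gt0.
have tE : [set s | t s < q `^ (0 - y)] = `]-oo, y[%classic.
  have lnq : ln q < 0 by rewrite ln_lt0// q0.
  apply/seteqP; split=> s /=; rewrite in_itv/= /t /powR gt_eqF// ltr_expR;
    by rewrite ltr_nM2r// ltrD2l ltrN2.
rewrite -tE; apply: (measure_eq_of_moments mD PD QD M0 _ mt tM).
  by rewrite powR_gt0.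
apply: (moments_eq_of_expansion mD PD QD M0 mt tM mh al0 hC PQ) => z z0 zM.
pose x := ln z / ln q.
have zE s : z * t s = q `^ (x - s).
  have -> : z = q `^ x.
    rewrite /powR gt_eqF// /x divfK ?lnK//.
    by rewrite ln_eq0// lt_eqF.
  by rewrite /t -powRD ?sub0r// (gt_eqF q0) implybT.
rewrite -[RHS](Lh x); last by rewrite -zE.
by apply: eq_integral_diff => s _; rewrite zE.
Qed.

End q_transform.

(** * The two directions of the correspondence *)

Section q_markov_krein_pairs.
Context {R : realType}.
Variables (a b q : R).
Hypotheses (ab : a < b) (q0 : 0 < q) (q1 : q < 1).
Local Notation D := (`[a, b]%classic : set (measurableTypeR R)).
Implicit Types (mu : probability (measurableTypeR R) R).
Implicit Types (tau : {charge set (measurableTypeR R) -> \bar R}).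

Let mD : measurable D. Proof. exact: measurable_itv. Qed.

Let lnq : ln q < 0. Proof. by rewrite ln_lt0// q0. Qed.

Lemma qpow_lt1 (x s : R) : (q `^ (x - s) < 1) = (s < x).
Proof.
by rewrite /powR gt_eqF// expR_lt1 nmulr_llt0// subr_gt0.
Qed.

Lemma qpow_gt1 (x s : R) : (1 < q `^ (x - s)) = (x < s).
Proof.
by rewrite /powR gt_eqF// expR_gt1 nmulr_lgt0// subr_lt0.
Qed.

(** For x > b the kernel is positive on [a, b], so the principal logarithm is real, the phase
    vanishes, and comparing real parts gives a real identity. *)
Lemma q_markov_krein_right mu tau (x : R) : q_markov_krein a b q mu tau ->
  b < x ->
  \int[mu]_(s in D) (1 - q `^ (x - s))^-1 =
  expR (charge_integral tau D (fun s : R => ln `|(1 - q `^ (x - s))^-1|)).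
Proof.
move=> mk bx; have xab : x \notin `[a, b].
  by rewrite in_itv/= negb_and -!ltNge bx orbT.
have /(congr1 (@complex.Re R)) := mk _ xab; rewrite /= => ->.
rewrite [X in cos X](_ : _ = 0) ?cos0 ?mulr1//.
have [p [n [_ intE]]] := charge_integral_jordan tau.
have im0 (s : R) : s \in D -> (if (1 - q `^ (x - s))^-1 < 0 then pi else 0) = 0 :> R.
  rewrite inE/= in_itv/= => /andP[_ sb].
  by rewrite invr_lt0 subr_lt0 ltNge ltW// qpow_lt1 (le_lt_trans sb).
rewrite intE.
under eq_Rintegral => s sD do rewrite im0//.
under [X in _ - X]eq_Rintegral => s sD do rewrite im0//.
by rewrite !Rintegral_cst// !mul0r subrr.
Qed.

(* For x < a the left-hand side is negative, whereas the phase pi * tau [a, b]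
   of the right-hand side would be 0. *)
Lemma q_markov_krein_mass_neq0 mu tau : q_markov_krein a b q mu tau ->
  tau D <> 0%E.
Proof.
move=> mk tau0; pose x := a - 1.
have xa : x < a by rewrite ltrBlDr ltrDl.
have xab : x \notin `[a, b] by rewrite in_itv/= negb_and -!ltNge xa.
have /(congr1 (@complex.Re R)) := mk _ xab; rewrite /=.
have [p [n [tauE intE]]] := charge_integral_jordan tau.
have sx (s : R) : D s -> (1 - q `^ (x - s))^-1 < 0.
  rewrite /= in_itv/= => /andP[as_ _].
  by rewrite invr_lt0 subr_lt0 qpow_gt1 (lt_le_trans xa).
rewrite [X in cos X](_ : _ = 0).
  rewrite cos0 mulr1 => h.
  have : 0 < \int[mu]_(s in D) (1 - q `^ (x - s))^-1 by rewrite h expR_gt0.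
  apply/negP; rewrite -leNgt /Rintegral.
  (* The integrand is the opposite of a nonnegative function, so its integral cannot be positive. *)
  under eq_integral => s _ do rewrite -[(1 - _)^-1]opprK EFinN.
  have g0 (s : R) : D s -> (0 <= (- (1 - q `^ (x - s))^-1)%:E)%E.
    by move=> /sx sx0; rewrite lee_fin oppr_ge0 ltW.
  by rewrite integral_ge0N// fineN oppr_le0 fine_ge0// integral_ge0.
have im (s : R) : s \in D -> (if (1 - q `^ (x - s))^-1 < 0 then pi else 0) = pi :> R.
  by rewrite inE => /sx ->.
rewrite intE.
under eq_Rintegral => s sD do rewrite im//.
under [X in _ - X]eq_Rintegral => s sD do rewrite im//.
rewrite !Rintegral_cst// -mulrBr -fineB ?fin_num_measure//.
by rewrite -tauE// tau0 mulr0.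
Qed.

Lemma rayleigh_pair_mass mu tau : is_rayleigh_measure a b tau ->
  q_markov_krein a b q mu tau ->
  [/\ tau D = 1%E,
      forall y, y <= a -> tau `]-oo, y[%classic = 0%E &
      forall y, b < y -> tau `]-oo, y[%classic = 1%E].
Proof.
by move=> /(rayleigh_mass ab)[tau0 /q_markov_krein_mass_neq0|//].
Qed.

Lemma measurable_log_kernel :
  measurable_fun [set: R] (fun y : R => ln `|(1 - y)^-1|).
Proof.
do 3 apply: measurableT_comp => //; first exact: measurable_invr.
by apply: measurable_funB => //; exact: measurable_cst.
Qed.

Lemma bounded_mfun_log_kernel (x : R) : q `^ (x - b) <= 2^-1 ->
  bounded_mfun D (fun s : R => ln `|(1 - q `^ (x - s))^-1|).
Proof.
move=> xb.
apply: (bounded_mfun_transform a (C := 1) q0 q1 measurable_log_kernel) => //.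
move=> y y2; have := log_expansion 0 y2.
by rewrite big_ord1 invr0 mul0r subr0 => /le_trans; apply; lra.
Qed.

(** Injectivity of [expR] turns equal left-hand sides into equal logarithmic transforms, which
    settles the rays inside [a, b]. Outside, both distribution functions are known: 0 up to [a], 1
    beyond [b]. *)
Lemma rayleigh_determined mu mu' tau tau' :
  is_rayleigh_measure a b tau -> is_rayleigh_measure a b tau' ->
  q_markov_krein a b q mu tau -> q_markov_krein a b q mu' tau' ->
  (forall A, measurable A -> mu A = mu' A) ->
  forall A, measurable A -> tau A = tau' A.
Proof.
move=> rtau rtau' mk mk' mumu'.
have [tD tl tr] := rayleigh_pair_mass rtau mk.
have [tD' tl' tr'] := rayleigh_pair_mass rtau' mk'.
have [P [Q [PQfin PQ intE]]] := charge_integral_diff mD tau tau'.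
have [PD QD] := PQfin _ mD.
have eqD : forall y, P (D `&` `]-oo, y[%classic) = Q (D `&` `]-oo, y[%classic).
  apply: (transform_determines_measure q0 q1 measurable_log_kernel
    (al := fun k => k%:R^-1)) => //.
  - case=> [|n]; last by exists 2 => y; exact: log_expansion.
    (* [log_expansion] starts at order 1; as the constant coefficient is 0, its bound 2 y <= 1 also
       serves for order 0. *)
    exists 1 => y y2; have := log_expansion 0 y2.
    rewrite big_ord1 big_ord0 invr0 mul0r !subr0 => /le_trans; apply; lra.
  - by apply/PQ => //; rewrite tD tD'.
  - move=> x xb; rewrite -intE; last exact: bounded_mfun_log_kernel.
    have bx : b < x by rewrite -qpow_lt1 (le_lt_trans xb)//; lra.
    apply/eqP; rewrite subr_eq0; apply/eqP/expR_inj.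
    rewrite -(q_markov_krein_right mk bx) -(q_markov_krein_right mk' bx).
    by rewrite /Rintegral (eq_measure_integral mu')// => A mA _; exact: mumu'.
move=> A mA; apply/(PQ _ mA); apply: measure_eq_of_rays => //.
  by move=> y; have [] := PQfin _ (measurable_itv `]-oo, y[).
move=> y; apply/PQ; first exact: measurable_itv.
have [ya|ay] := leP y a; first by rewrite tl// tl'.
have [yb|yb] := ltP b y; first by rewrite tr// tr'.
have split_ray (nu : {charge set (measurableTypeR R) -> \bar R}) :
    nu `]-oo, y[%classic =
    (nu `]-oo, a[%classic + nu (D `&` `]-oo, y[%classic))%E.
  rewrite -chargeU; [|exact: measurable_itv| |].
  - congr (nu _); apply/seteqP; split=> s /=; rewrite !in_itv/=.
      move=> sy; have [sa|as_] := ltP s a; [by left|right].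
      by rewrite (le_trans (ltW sy)).
    by case=> [/lt_trans|[]//]; exact.
  - by apply: measurableI => //; exact: measurable_itv.
  - rewrite -subset0 => s /=; rewrite !in_itv/= => -[sa [/andP[as_ _] _]].
    by move: sa; rewrite ltNge as_.
rewrite !split_ray tl// tl'//; congr (_ + _)%E; apply/PQ => //.
by apply: measurableI => //; exact: measurable_itv.
Qed.

Lemma measurable_cauchy_kernel :
  measurable_fun [set: R] (fun y : R => (1 - y)^-1).
Proof.
apply: (measurableT_comp measurable_invr).
by apply: measurable_funB => //; exact: measurable_cst.
Qed.

Lemma probability_determined mu mu' tau tau' :
  probability_on a b mu -> probability_on a b mu' ->
  q_markov_krein a b q mu tau -> q_markov_krein a b q mu' tau' ->
  (forall A, measurable A -> tau A = tau' A) ->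
  forall A, measurable A -> mu A = mu' A.
Proof.
move=> mu1 mu1' mk mk' tautau'.
have [P [Q [PQfin PQ intE]]] := charge_integral_diff mD tau tau'.
have eqD : forall y, mu (D `&` `]-oo, y[%classic) = mu' (D `&` `]-oo, y[%classic).
  apply: (transform_determines_measure q0 q1 measurable_cauchy_kernel
    (al := fun=> 1)) => //.
  - by move=> n; exists 2 => y; exact: geometric_expansion.
  - by rewrite [ltLHS]mu1 ltry.
  - by rewrite [ltLHS]mu1' ltry.
  - by rewrite [LHS]mu1 [RHS]mu1'.
  - move=> x xb; have bx : b < x by rewrite -qpow_lt1 (le_lt_trans xb)//; lra.
    rewrite /integral_diff (q_markov_krein_right mk bx).
    rewrite (q_markov_krein_right mk' bx).
    apply/eqP; rewrite subr_eq0; apply/eqP; congr expR; apply/eqP.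
    (* Jordan parts chosen separately for the two charges are not compared directly; equality of the
       charges is used as equality of [P] and [Q]. *)
    rewrite -subr_eq0 intE; last exact: bounded_mfun_log_kernel.
    rewrite /integral_diff /Rintegral (eq_measure_integral Q) ?subrr//.
    by move=> A mA _; apply/PQ => //; exact: tautau'.
(* Full mass on [a, b] makes the complement null, so agreement on traces of rays on [a, b]
   suffices. *)
have muD (m : probability (measurableTypeR R) R) (A : set (measurableTypeR R)) :
    probability_on a b m -> measurable A -> m A = m (D `&` A).
  move=> m1 mA; rewrite (measureDI m mA mD) setIC.
  rewrite [X in (X + _)%E](_ : _ = 0%E) ?add0e//.
  apply/eqP; rewrite -measure_le0.
  have mDC : m (~` D) = 0%E by rewrite probability_setC// [X in (_ - X)%E]m1 subee.
  rewrite -mDC; apply: le_measure; last by move=> ? [].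
  - by rewrite inE; exact: measurableD.
  - by rewrite inE; exact: measurableC.
move=> A mA; apply: measure_eq_of_rays => // y.
  by rewrite (le_lt_trans (probability_le1 _ _))// ?ltry//; exact: measurable_itv.
have mray : measurable (`]-oo, y[%classic : set (measurableTypeR R)).
  exact: measurable_itv.
by rewrite [LHS](muD mu)// [RHS](muD mu')// eqD.
Qed.

End q_markov_krein_pairs.

Theorem theorem4p13 (R : realType) (a b q : R)
    (ha : a < 0) (hb : 0 < b) (hq0 : 0 < q) (hq1 : q < 1)
    (mu mu' : probability (measurableTypeR R) R)
    (tau tau' : {charge set (measurableTypeR R) -> \bar R})
    (hmu : probability_on a b mu) (hmu' : probability_on a b mu')
    (htau : is_rayleigh_measure a b tau)
    (htau' : is_rayleigh_measure a b tau')
    (hpair : q_markov_krein a b q mu tau)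
    (hpair' : q_markov_krein a b q mu' tau') :
  (forall A : set (measurableTypeR R), measurable A -> mu A = mu' A) <->
  (forall A : set (measurableTypeR R), measurable A -> tau A = tau' A).
Proof.
have ab : a < b := lt_trans ha hb.
split.
- exact: (rayleigh_determined ab hq0 hq1 htau htau' hpair hpair').
- exact: (probability_determined hq0 hq1 hmu hmu' hpair hpair').
Qed.
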